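(* Let $G$ be a DAG with $n$ vertices. If $G$ is transitively closed and contains no splits, then $\mathcal P^G(\mathcal X)$ is weakly closed (for every product $\mathcal X=\prod_{v\in V}\mathcal X_v$ of Polish spaces). Otherwise, $\mathcal P^G(\mathbb R^n)$ (i.e. with every $\mathcal X_v=\mathbb R$) is not weakly closed.
   Context: Directed graphs $G=(V,E)$ have a finite vertex set $V$ and edge set $E\subseteq\{(i,j)\in V\times V: i\neq j\}$; $\mathrm{pa}_i=\{j:(j,i)\in E\}$ is the set of parents of $i$, $\mathrm{an}_i$ is the set of ancestors of $i$ (vertices from which there is a directed path of length at least one to $i$), and $\mathrm{dsc}_i=\{j: i\in\mathrm{an}_j\}$. $G$ is a DAG if $i\notin\mathrm{an}_i$ for all $i$. $G$ is transitively closed if $i\in\mathrm{pa}_j$ and $j\in\mathrm{pa}_k$ imply $i\in\mathrm{pa}_k$. A split is a triplet $(i,j,k)$ of vertices (with $j\ne k$) such that $i\in\mathrm{pa}_j\cap\mathrm{pa}_k$ but $j\notin\mathrm{pa}_k$ and $k\notin\mathrm{pa}_j$. For a product of Polish spaces $\mathcal X=\prod_{v\in V}\mathcal X_v$ and $A\subseteq V$, $X_A$ denotes the projection of a random variable $X$ in $\mathcal X$ onto $\prod_{v\in A}\mathcal X_v$. $\mathcal P(\mathcal X)$ is the set of Borel probability measures on $\mathcal X$ with the topology of weak convergence. $\mu\in\mathcal P(\mathcal X)$ is $G$-compatible if, for $X\sim\mu$ and every $i\in V$, $X_i$ is conditionally independent of $X_{V\setminus(\mathrm{dsc}_i\cup\{i\})}$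 given $X_{\mathrm{pa}_i}$. $\mathcal P^G(\mathcal X)$ is the set of $G$-compatible measures. *)

(* Defs.v *)
From HB Require Import structures.
From mathcomp Require Import all_boot all_order all_algebra.
From mathcomp Require Import all_classical all_reals all_analysis.

Set Implicit Arguments.
Unset Strict Implicit.
Unset Printing Implicit Defensive.

Import Order.TTheory GRing.Theory Num.Theory numFieldNormedType.Exports.

Local Open Scope classical_set_scope.
Local Open Scope ring_scope.

Record digraph (V : finType) := Digraph {
  edge :> rel V;
  edge_irrefl : irreflexive edge }.

Section Graphs.
Variables (V : finType) (G : digraph V).

Definition pa (i : V) : {set V} := [set j | G j i]%SET.

Definition an (i : V) : {set V} :=
  [set j | `[< exists2 p : seq V, p != [::] & path G j p /\ last j p = i >]]%SET.

Definition dsc (i : V) : {set V} := [set j | i \in an j]%SET.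

Definition is_dag : Prop := forall i, i \notin an i.

Definition transitively_closed : Prop :=
  forall i j k, i \in pa j -> j \in pa k -> i \in pa k.

Definition is_split (i j k : V) : Prop :=
  [/\ j != k, i \in pa j :&: pa k, j \notin pa k & k \notin pa j].

Definition has_split : Prop := exists i j k, is_split i j k.

End Graphs.

Definition separable (T : topologicalType) : Prop :=
  exists2 D : set T, countable D & dense D.

Definition completely_metrizable (R : realType) (T : topologicalType) : Prop :=
  exists (M : metricType R) (f : T -> M) (g : M -> T),
    [/\ continuous f, continuous g, cancel f g, cancel g f &
        forall F : set_system M, ProperFilter F -> cauchy F ->
          exists x : M, F --> x].

Definition polish (R : realType) (T : topologicalType) : Prop :=
  separable T /\ completely_metrizable R T.

HB.instance Definition _ (I : Type) (T : I -> ptopologicalType) :=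
  Pointed.on (prod_topology T).

(* The library's measurable types are pointed, hence ptopologicalType; on an
   empty space there is no probability measure at all. *)
Notation borel T := (g_sigma_algebraType (@open T)).

Section WeakConvergence.
Variables (R : realType) (T : ptopologicalType).

Definition bounded_continuous : Type :=
  {f : T -> R | continuous f /\ bounded_fun f}.

Definition integral_functional (mu : probability (borel T) R) :
    {ptws bounded_continuous -> R} :=
  fun f => (\int[mu]_x sval f x)%R.

(* The coarsest topology making mu |-> \int f dmu continuous for every bounded
   continuous f. *)
Definition weak_probability : Type := initial_topology integral_functional.

End WeakConvergence.

Section ConditionalIndependence.
Context (R : realType) (d d1 d2 d3 : measure_display).
Context (T : measurableType d) (T1 : measurableType d1)
  (T2 : measurableType d2) (T3 : measurableType d3).
Variable P : probability T R.

(* h is a version of P(A | Z) *)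
Definition cond_prob (Z : T -> T3) (A : set T) (h : T -> R) : Prop :=
  [/\ measurable_fun [set: g_sigma_algebra_preimageType Z] h,
      P.-integrable setT (EFin \o h) &
      forall D, g_sigma_algebra_preimage Z D ->
        (\int[P]_(x in D) (h x)%:E = P (A `&` D))%E].

(* P(X in B1, Y in B2 | Z) = P(X in B1 | Z) P(Y in B2 | Z) almost surely.
   Versions exist by Radon-Nikodym and agree almost surely, so asking for
   some versions is the same as asking for all of them. *)
Definition cond_indep (X : T -> T1) (Y : T -> T2) (Z : T -> T3) : Prop :=
  forall (B1 : set T1) (B2 : set T2), measurable B1 -> measurable B2 ->
    exists p q r : T -> R,
      [/\ cond_prob Z (X @^-1` B1) p, cond_prob Z (Y @^-1` B2) q,
          cond_prob Z (X @^-1` B1 `&` Y @^-1` B2) r &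
          {ae P, forall x, r x = p x * q x}].

End ConditionalIndependence.

Section Compatible.
Variables (R : realType) (V : finType) (G : digraph V).
Variable X : V -> ptopologicalType.

Definition subproduct (A : {set V}) : Type :=
  prod_topology (fun v : {v : V | v \in A} => X (val v)).

Definition projection (A : {set V}) (x : borel (prod_topology X)) :
  borel (subproduct A) := fun v => x (val v).

Definition coordinate (i : V) (x : borel (prod_topology X)) : borel (X i) := x i.

Definition compatible (mu : probability (borel (prod_topology X)) R) : Prop :=
  forall i : V,
    cond_indep mu (@coordinate i) (@projection (~: (dsc G i :|: [set i]))%SET)
      (@projection (pa G i)).

Definition compatible_measures : set (weak_probability R (prod_topology X)) :=
  [set mu | compatible mu].

End Compatible.

Arguments compatible_measures R {V} G X.

(* Main.v *)
Require Import Defs.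
From HB Require Import structures.
From mathcomp Require Import all_boot all_order all_algebra.
From mathcomp Require Import all_classical all_reals all_analysis.
From mathcomp Require Import measurable_realfun ring lra.

(** The first half rests on a reformulation of compatibility that involves only
    unconditional independence.  If [G] is transitively closed and has no
    splits, then [i] together with its parents, and the set of vertices
    incomparable to [i], are two disjoint sets closed under taking parents.
    Removing sinks one at a time shows that a compatible measure makes the
    blocks of two such sets independent; conversely, independence of these two
    blocks for every [i] gives back compatibility.  Independence of two blocks
    says that [mu (f g) = mu f * mu g] for products [f], [g] of continuous
    functions of the single coordinates, and this is a weakly closed condition.

    For the second half, choose [m], [a], [b] such that either [a -> m -> b]
    with no edge from [a] to [b], or [m -> a] and [m -> b] with [a], [b] not
    adjacent.  Let a fair random sign be seen at [a] and [b], and [e] times it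
    at [m].  For [e <> 0] the sign can be read off at [m], and the law is
    compatible; at [e = 0] it is lost at [m], although [a] and [b] still
    share it. *)

Set Implicit Arguments.
Unset Strict Implicit.
Unset Printing Implicit Defensive.

Import Order.TTheory GRing.Theory Num.Theory numFieldNormedType.Exports.

Local Open Scope classical_set_scope.
Local Open Scope ring_scope.

(** * Conditional probability *)

(* Here and in [trace_measure], the unused proofs are arguments in order that
   the measure structure be inferred. *)
Definition density_measure d (T : measurableType d) (R : realType)
    (mu : {measure set T -> \bar R}) (f : T -> \bar R)
    (f0 : forall x, (0 <= f x)%E) (fi : mu.-integrable setT f) :
  set T -> \bar R := fun A => (\int[mu]_(x in A) f x)%E.

Section DensityMeasure.
Context d (T : measurableType d) (R : realType) (mu : {measure set T -> \bar R}).
Variable f : T -> \bar R.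
Hypotheses (f0 : forall x, (0 <= f x)%E) (fi : mu.-integrable setT f).

Local Notation density := (density_measure f0 fi).

Let density0 : density set0 = 0%E.
Proof. exact: integral_set0. Qed.

Let density_ge0 A : (0 <= density A)%E.
Proof. exact: integral_ge0. Qed.

Let density_sigma_additive : semi_sigma_additive density.
Proof.
by apply: semi_sigma_additive_nng_induced => //; exact: measurable_int fi.
Qed.

HB.instance Definition _ := isMeasure.Build _ _ _ density
  density0 density_ge0 density_sigma_additive.

Let density_fin : fin_num_fun density.
Proof.
by move=> A mA; apply: integrable_fin_num => //; exact: integrableS fi.
Qed.

HB.instance Definition _ := Measure_isFinite.Build _ _ _ density density_fin.

End DensityMeasure.

(** The hypothesis makes [nu] absolutely continuous with respect to [mu]. Uniqueness of densities
    identifies [g] almost everywhere with the Radon-Nikodym derivative, to which the change of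
    variables applies. *)
Lemma ge0_integral_density d (T : measurableType d) (R : realType)
    (nu mu : {finite_measure set T -> \bar R}) (g f : T -> \bar R) (D : set T) :
  measurable_fun setT g ->
  (forall E, measurable E -> nu E = \int[mu]_(x in E) g x)%E ->
  measurable D -> measurable_fun D f -> (forall x, 0 <= f x)%E ->
  (\int[nu]_(x in D) f x = \int[mu]_(x in D) (f x * g x))%E.
Proof.
move=> mg nuE mD mf f0.
have numu : nu `<< mu.
  apply/null_content_dominatesP => A mA mu0.
  by rewrite nuE// null_set_integral//; exact: measurable_funTS.
rewrite -(Radon_Nikodym_SigmaFinite.change_of_variables numu)//.
apply: ae_eq_integral => //.
- apply: emeasurable_funM => //; apply: measurable_funTS.
  exact: measurable_int (Radon_Nikodym_SigmaFinite.f_integrable _).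
- by apply: emeasurable_funM => //; exact: measurable_funTS.
apply: ae_eqe_mul2l; apply: integral_ae_eq => //.
- apply: (integrableS measurableT) => //.
  exact: Radon_Nikodym_SigmaFinite.f_integrable.
- exact: measurable_funTS.
- by move=> E _ mE; rewrite -Radon_Nikodym_SigmaFinite.f_integral// nuE.
Qed.

Lemma ge0_integral_mrestr d (T : measurableType d) (R : realType)
    (mu : {finite_measure set T -> \bar R}) (A D : set T) (mA : measurable A)
    (f : T -> \bar R) :
  measurable D -> measurable_fun setT f -> (forall x, 0 <= f x)%E ->
  (\int[mrestr mu mA]_(x in D) f x = \int[mu]_(x in D `&` A) f x)%E.
Proof.
move=> mD mf f0.
rewrite (@ge0_integral_density _ _ _ (mrestr mu mA) mu (EFin \o \1_A))//.
- rewrite integral_mkcondr; apply: eq_integral => x _.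
  by rewrite epatch_indic.
- exact/measurable_EFinP.
- by move=> E mE; rewrite integral_indic// setIC.
- exact: measurable_funTS.
Qed.

Definition trace_measure (R : realType) (d d' : measure_display)
    (T : measurableType d) (T' : measurableType d') (Z : T -> T')
    (mZ : measurable_fun setT Z) (mu : set T -> \bar R) :
  set (g_sigma_algebra_preimageType Z) -> \bar R := mu.

Section ConditionalProbability.
Context (R : realType) (d d' : measure_display).
Context (T : measurableType d) (T' : measurableType d').
Variables (P : probability T R) (Z : T -> T').
Hypothesis mZ : measurable_fun setT Z.

Local Notation TZ := (g_sigma_algebra_preimageType Z).

(** The identity, seen as a map onto the coarser sigma-algebra of [Z]. The trace of a measure is its
    pushforward along this map, which gives the integrals against the trace. *)
Let forget : T -> TZ := idfun.

Lemma preimage_measurable (D : set T) :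
  g_sigma_algebra_preimage Z D -> measurable D.
Proof. by case=> B mB <-; exact: mZ. Qed.

Let mforget : measurable_fun setT forget.
Proof. by move=> _ Y mY; rewrite setTI; exact: preimage_measurable. Qed.

Lemma measurable_fun_preimage d1 (Y : measurableType d1) (f : T -> Y) :
  measurable_fun [set: TZ] f -> measurable_fun setT f.
Proof.
by move=> mf _ B mB; apply: preimage_measurable; exact: mf.
Qed.

Section Trace.
Variable mu : {finite_measure set T -> \bar R}.

Local Notation trace_mu := (trace_measure mZ mu).

Let trace0 : trace_mu set0 = 0%E.
Proof. exact: (measure0 mu). Qed.

Let trace_ge0 A : (0 <= trace_mu A)%E.
Proof. by rewrite /trace_mu measure_ge0. Qed.

Let trace_sigma_additive : semi_sigma_additive trace_mu.
Proof.
move=> F mF tF mUF; apply: (@measure_semi_sigma_additive _ _ _ mu) => //.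
- by move=> n; exact: preimage_measurable (mF n).
- exact: preimage_measurable mUF.
Qed.

HB.instance Definition _ := isMeasure.Build _ _ _ trace_mu
  trace0 trace_ge0 trace_sigma_additive.

Let trace_fin : fin_num_fun trace_mu.
Proof.
by move=> A mA; apply: (fin_num_measure mu); exact: preimage_measurable.
Qed.

HB.instance Definition _ := Measure_isFinite.Build _ _ _ trace_mu trace_fin.

Lemma ge0_integral_trace (D : set TZ) (f : TZ -> \bar R) :
  measurable D -> measurable_fun setT f -> (forall x, 0 <= f x)%E ->
  (\int[trace_mu]_(x in D) f x = \int[mu]_(x in D) f x)%E.
Proof.
move=> mD mf f0.
by rewrite -[RHS](ge0_integral_pushforward mforget)//; exact: measurable_funTS.
Qed.

Lemma integrable_trace (f : TZ -> \bar R) :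
  measurable_fun setT f -> mu.-integrable setT f ->
  trace_mu.-integrable setT f.
Proof.
move=> mf fi.
exact: (@integrable_pushforward _ _ _ _ _ _ mforget mu setT f mf fi measurableT).
Qed.

Lemma integral_trace (D : set TZ) (f : TZ -> \bar R) :
  measurable D -> measurable_fun setT f -> mu.-integrable setT f ->
  (\int[trace_mu]_(x in D) f x = \int[mu]_(x in D) f x)%E.
Proof.
move=> mD mf fi.
rewrite -[RHS](@integral_pushforward _ _ _ _ _ _ mforget mu D f mf _ mD)//.
by apply: integrableS fi => //; exact: preimage_measurable mD.
Qed.

End Trace.

(** Both versions have the same integrals over the sigma-algebra of [Z], so they agree outside a
    null set of the trace, which is also a null set of [P]. *)
Lemma cond_prob_ae_eq (A : set T) (p q : T -> R) :
  cond_prob P Z A p -> cond_prob P Z A q -> {ae P, forall x, p x = q x}.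
Proof.
move=> [mp ip pE] [mq iq qE].
have : ae_eq (trace_measure mZ P) setT (EFin \o p) (EFin \o q).
  apply: integral_ae_eq => //.
  - by apply: integrable_trace => //; exact/measurable_EFinP.
  - exact/measurable_EFinP.
  - move=> D _ mD; rewrite !integral_trace//; [|exact/measurable_EFinP..].
    by rewrite pE// qE.
case=> N [mN N0 sN]; exists N; split => //; first exact: preimage_measurable.
by move=> x /= npq; apply: sN => /= /(_ Logic.I)[].
Qed.

(** The version is the Radon-Nikodym derivative of the trace of [P] restricted to [A] with respect
    to the trace of [P]. Its nonnegativity gives access to the integral identities for nonnegative
    functions. *)
Lemma cond_prob_ex (A : set T) : measurable A ->
  exists2 p : T -> R, cond_prob P Z A p & forall x, 0 <= p x.
Proof.
move=> mA.
pose nu := trace_measure mZ (mrestr P mA).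
have numu : nu `<< trace_measure mZ P.
  apply/null_content_dominatesP => D mD PD0; apply/eqP.
  rewrite eq_le measure_ge0 andbT -PD0.
  apply: le_measure; rewrite ?inE//; last exact: preimage_measurable.
  by apply: measurableI => //; exact: preimage_measurable.
pose f := Radon_Nikodym_SigmaFinite.f nu (trace_measure mZ P).
have f0 := Radon_Nikodym_SigmaFinite.f_ge0 numu.
have ffin := Radon_Nikodym_SigmaFinite.f_fin_num numu.
have fi := Radon_Nikodym_SigmaFinite.f_integrable numu.
have mf : measurable_fun [set: TZ] f by exact: measurable_int fi.
have fE x : (fine (f x))%:E = f x by rewrite fineK.
have int_f D : g_sigma_algebra_preimage Z D ->
    (\int[P]_(x in D) f x = P (A `&` D))%E.
  move=> mD; rewrite -ge0_integral_trace//.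
  by rewrite -Radon_Nikodym_SigmaFinite.f_integral// setIC.
exists (fine \o f); last by move=> x; exact: fine_ge0.
split.
- exact: measurableT_comp.
- rewrite (_ : _ \o _ = f); last exact/funext.
  apply/integrableP; split; first exact: measurable_fun_preimage.
  under eq_integral do rewrite gee0_abs//.
  rewrite int_f; last exact: (@measurableT _ TZ).
  by rewrite (le_lt_trans (probability_le1 _ _)) ?ltry// setIT.
- by move=> D mD /=; under eq_integral do rewrite fE; exact: int_f.
Qed.

(** The pull-out property: on the sigma-algebra of [Z], [q] is the density of [P] restricted to
    [A]. *)
Lemma ge0_integral_cond_probM (A D : set T) (p : T -> \bar R) (q : T -> R) :
  measurable A -> cond_prob P Z A q ->
  measurable_fun [set: TZ] p -> (forall x, 0 <= p x)%E ->
  (forall x, 0 <= q x) -> g_sigma_algebra_preimage Z D ->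
  (\int[P]_(x in D) (p x * (q x)%:E) = \int[P]_(x in D `&` A) p x)%E.
Proof.
move=> mA [mq iq qE] mp p0 q0 mD.
have mD' : measurable D by exact: preimage_measurable.
have mp' := measurable_fun_preimage mp.
rewrite -ge0_integral_mrestr// -[RHS]ge0_integral_trace//.
rewrite (@ge0_integral_density _ _ _ _ (trace_measure mZ P) (EFin \o q))//.
- rewrite [RHS]ge0_integral_trace//.
    by apply: emeasurable_funM => //; exact/measurable_EFinP.
  by move=> x; rewrite mule_ge0// lee_fin.
- exact/measurable_EFinP.
- move=> E mE; rewrite ge0_integral_trace//; first by rewrite qE// setIC.
    exact/measurable_EFinP.
- exact: measurable_funTS.
Qed.

End ConditionalProbability.

(** * Conditional independence as an identity of integrals *)

Section ConditionalIndependence.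
Context (R : realType) (d d1 d2 d3 : measure_display).
Context (T : measurableType d) (T1 : measurableType d1)
  (T2 : measurableType d2) (T3 : measurableType d3).
Variables (P : probability T R) (X : T -> T1) (Y : T -> T2) (Z : T -> T3).
Hypotheses (mX : measurable_fun setT X) (mY : measurable_fun setT Y)
  (mZ : measurable_fun setT Z).

Let mXB B : measurable B -> measurable (X @^-1` B).
Proof. by move=> mB; rewrite -[_ @^-1` _]setTI; exact: mX. Qed.

Let mYB B : measurable B -> measurable (Y @^-1` B).
Proof. by move=> mB; rewrite -[_ @^-1` _]setTI; exact: mY. Qed.

(** With [q] a version of the conditional probability of the event of [Y], the left side is the
    integral of [p * q] by the pull-out property, and [p * q] is almost surely a version for the
    joint event. *)
Lemma cond_indep_integral (B1 : set T1) (p : T -> R) : measurable B1 ->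
  cond_indep P X Y Z -> cond_prob P Z (X @^-1` B1) p -> (forall x, 0 <= p x) ->
  forall B2, measurable B2 ->
    (\int[P]_(x in Y @^-1` B2) (p x)%:E = P (X @^-1` B1 `&` Y @^-1` B2))%E.
Proof.
move=> mB1 ciXYZ pP p0 B2 mB2.
have [q qP q0] := cond_prob_ex P mZ (mYB mB2).
have [[mpZ _ _] [mqZ _ _]] := (pP, qP).
have [p' [q' [r [pP' qP' [mr ir rE] rpq]]]] := ciXYZ B1 B2 mB1 mB2.
have mT : g_sigma_algebra_preimage Z setT.
  exact: (@measurableT _ (g_sigma_algebra_preimageType Z)).
have mp := measurable_fun_preimage mZ mpZ.
rewrite -[S in P S]setIT -rE// -[Y @^-1` B2]setTI.
rewrite -(ge0_integral_cond_probM (p := EFin \o p) mZ _ qP)//; last 2 first.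
- exact: mYB.
- exact/measurable_EFinP/mpZ.
apply: ae_eq_integral => //.
- apply: emeasurable_funM; first exact/measurable_EFinP.
  exact/measurable_EFinP/(measurable_fun_preimage mZ mqZ).
- exact/measurable_EFinP/(measurable_fun_preimage mZ mr).
have := cond_prob_ae_eq mZ pP pP'; have := cond_prob_ae_eq mZ qP qP'.
by move: rpq; apply: filterS3 => x /= -> -> -> _; rewrite EFinM.
Qed.

(** A converse of [cond_indep_integral]. Since the events of [Z] are events of [Y], intersecting one
    with an event of [Y] leaves an event of [Y], so the hypothesis on [p] shows that [p * q] is a
    version for the joint event. *)
Lemma integral_cond_indep :
  g_sigma_algebra_preimage Z `<=` g_sigma_algebra_preimage Y ->
  (forall B1, measurable B1 -> exists p : T -> R,
    [/\ cond_prob P Z (X @^-1` B1) p, forall x, 0 <= p x &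
      forall B2, measurable B2 ->
        (\int[P]_(x in Y @^-1` B2) (p x)%:E =
         P (X @^-1` B1 `&` Y @^-1` B2))%E]) ->
  cond_indep P X Y Z.
Proof.
move=> ZY H B1 B2 mB1 mB2; have [p [pP p0 pE]] := H _ mB1.
have [q qP q0] := cond_prob_ex P mZ (mYB mB2).
have [[mpZ _ _] [mqZ _ _]] := (pP, qP).
have mp := measurable_fun_preimage mZ mpZ.
have mq := measurable_fun_preimage mZ mqZ.
have pqE D : g_sigma_algebra_preimage Z D ->
    (\int[P]_(x in D) (p x * q x)%:E =
     P ((X @^-1` B1 `&` Y @^-1` B2) `&` D))%E.
  move=> mD; under eq_integral do rewrite EFinM.
  rewrite (ge0_integral_cond_probM (p := EFin \o p) mZ _ qP)//; last 2 first.
  - exact: mYB.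
  - exact/measurable_EFinP/mpZ.
  have [B mB <-] := ZY _ mD.
  rewrite setTI -preimage_setI pE; last exact: measurableI.
  by rewrite preimage_setI -setIA [_ `&` Y @^-1` B2]setIC.
exists p, q, (fun x => p x * q x); split => //; last exact: aeW.
split => //.
- by apply: measurable_funM; [exact: mpZ|exact: mqZ].
- apply/integrableP; split.
    by apply/measurable_EFinP; exact: measurable_funM.
  under eq_integral => x _ do rewrite /= ger0_norm ?mulr_ge0//.
  rewrite pqE; last exact: (@measurableT _ (g_sigma_algebra_preimageType Z)).
  rewrite (le_lt_trans (probability_le1 _ _)) ?ltry// setIT.
  by apply: measurableI; [exact: mXB|exact: mYB].
Qed.

End ConditionalIndependence.

(** * Borel sets of a product *)

Lemma continuous_borel_measurable (S T : ptopologicalType)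
    (f : borel S -> borel T) :
  continuous (f : S -> T) -> measurable_fun setT f.
Proof.
move=> cf; apply: (@measurability _ _ (borel S) (borel T) setT f (@open T) erefl).
move=> _ [U oU <-]; rewrite setTI; apply: sub_sigma_algebra.
by move/continuousP : cf; exact.
Qed.

Lemma continuous_prod_topology (S : topologicalType) (I : Type)
    (K : I -> topologicalType) (f : S -> prod_topology K) :
  (forall i, continuous (fun x => f x i)) -> continuous f.
Proof.
move=> cf x; apply/cvg_sup => i U [_ [[W oW <-] Wfx] WU].
have : nbhs x ((fun x => f x i) @^-1` W).
  by apply: (cf i x); exact: open_nbhs_nbhs.
by apply: filterS => y /= Wy; exact: WU.
Qed.

Section Box.
Context (I : Type) (K : I -> topologicalType).

Definition box (A : pred I) (U : forall i, set (K i)) : set (prod_topology K) :=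
  [set x | forall i, A i -> U i (x i)].

(* The neighbourhoods of [x] in the box topology form a filter, which converges
   to [x] in the product topology. *)
Lemma nbhs_box (x : prod_topology K) (O : set (prod_topology K)) : nbhs x O ->
  exists U : forall i, set (K i),
    [/\ forall i, open (U i), box predT U x & box predT U `<=` O].
Proof.
pose F : set_system (prod_topology K) := fun O =>
  exists U : forall i, set (K i),
    [/\ forall i, open (U i), box predT U x & box predT U `<=` O].
suff : F --> x by apply.
have FF : Filter F.
  split.
  - exists (fun=> setT); split => //.
    by move=> i; exact: openT.
  - move=> A B [U [oU Ux UA]] [W [oW Wx WB]].
    exists (fun i => U i `&` W i); split.
    + by move=> i; exact: openI.
    + by move=> i _; split; [exact: Ux|exact: Wx].
    + move=> y UWy; split; [apply: UA|apply: WB] => i /UWy[]//.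
  - move=> A B AB [U [oU Ux UA]]; exists U; split => //.
    exact: subset_trans AB.
apply/cvg_sup => i O' [_ [[W oW <-] Wx] WO'].
have [U [oU Ux UW]] : exists U : forall j, set (K j),
    [/\ forall j, open (U j), box predT U x &
        box predT U `<=` (fun f : prod_topology K => f i) @^-1` W].
  (* The side is [W] at [i] and the whole space elsewhere; transport along [i = j] expresses this
     without deciding equality of indices. *)
  exists (fun j => [set y | forall e : i = j, W (ecast k (K k) (esym e) y)]).
  split.
  - move=> j; case: (pselect (i = j)) => [ij|nij].
      case: _ / ij; rewrite (_ : [set _ | _] = W)//.
      apply/seteqP; split => [y /(_ erefl)//|y Wy e].
      by rewrite (Prop_irrelevance e erefl).
    rewrite (_ : [set _ | _] = setT); first exact: openT.
    by apply/seteqP; split => // y _ e.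
  - by move=> j _ e; case: _ / e.
  - by move=> y /(_ i isT) /(_ erefl).
by exists U; split => //; exact: subset_trans WO'.
Qed.

End Box.

Section BorelProduct.
Context (I : finType) (K : I -> ptopologicalType).

Lemma measurable_box (A : pred I) (U : forall i, set (K i)) :
  (forall i, open (U i)) -> measurable (box A U : set (borel (prod_topology K))).
Proof.
move=> oU.
rewrite (_ : box A U = \bigcap_(i in [set i | A i]) ((fun x => x i) @^-1` U i))//.
apply: (@fin_bigcap_measurable _ (borel (prod_topology K))) => // i _.
apply: sub_sigma_algebra.
by move/(@continuousP (prod_topology K) (K i)): (@proj_continuous I K i); apply.
Qed.

Definition open_boxes (A : pred I) : set (set (prod_topology K)) :=
  [set B | exists2 U : forall i, set (K i),
    (forall i, open (U i)) & B = box A U].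

Lemma open_boxesI (A : pred I) : setI_closed (open_boxes A).
Proof.
move=> _ _ [U oU ->] [W oW ->]; exists (fun i => U i `&` W i).
  by move=> i; exact: openI.
apply/seteqP; split => [x [xU xW] i Ai|x xUW].
  by split; [exact: xU|exact: xW].
by split => i /xUW[].
Qed.

Lemma open_boxesT (A : pred I) : open_boxes A setT.
Proof.
exists (fun=> setT); first by move=> i; exact: openT.
by apply/seteqP; split.
Qed.

(** An open set is the union of the boxes inside it whose sides come from countable bases. As [I] is
    finite, there are countably many such boxes. *)
Lemma borel_prod_boxes : (forall i, @second_countable (K i)) ->
  @measurable _ (borel (prod_topology K)) = <<s open_boxes predT >>.
Proof.
move=> scK; apply/seteqP; split; last first.
  apply: smallest_sub; first exact: smallest_sigma_algebra.
  by move=> _ [U oU ->]; exact: measurable_box.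
apply: smallest_sub; first exact: smallest_sigma_algebra.
move=> O oO.
pose B i : set (set (K i)) := s2val (cid2 (scK i)).
have cB i : countable (B i) := s2valP (cid2 (scK i)).
have bB i : basis (B i) := s2valP' (cid2 (scK i)).
have eB i : exists e : nat -> set (K i), set_surj setT (B i) e.
  by apply/pcard_surjP; exact: cB.
pose e i := sval (cid (eB i)).
have esurj i : set_surj setT (B i) (e i) := svalP (cid (eB i)).
(* [e i] reaches every member of the base but may take other values as well, so openness of the
   sides has to be required. *)
pose good (phi : {ffun I -> nat}) :=
  (forall i, open (e i (phi i))) /\ box predT (fun i => e i (phi i)) `<=` O.
pose F (phi : {ffun I -> nat}) : set (borel (prod_topology K)) :=
  if `[< good phi >] then box predT (fun i => e i (phi i)) else set0.
rewrite (_ : O = \bigcup_phi F phi).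
  apply: (@countable_bigcupT_measurable _
    (g_sigma_algebraType (open_boxes predT))) => //.
  move=> phi; rewrite /F; case: asboolP => [[? _]|_]; last exact: measurable0.
  by apply: sub_sigma_algebra; exists (fun i => e i (phi i)).
apply/seteqP; split => [x Ox|x [phi _]]; last first.
  by rewrite /F; case: asboolP => // -[_]; exact.
have [U [oU Ux UO]] := nbhs_box (open_nbhs_nbhs (conj oO Ox)).
have H i : exists n, [/\ open (e i n), e i n (x i) & e i n `<=` U i].
  have [Bo Bx] := bB i.
  have [W [BW Wx] WU] := Bx (x i) (U i) (open_nbhs_nbhs (conj (oU i) (Ux i isT))).
  have [n _ en] := esurj i W BW.
  by exists n; rewrite en; split => //; exact: Bo.
have [phi phiP] := choice H.
exists (finfun phi) => //; rewrite /F; case: asboolP => [_|].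
  by move=> i _; rewrite ffunE; have [] := phiP i.
case; split; first by move=> i; rewrite ffunE; have [] := phiP i.
move=> y ye; apply: UO => i _; have := ye i isT; rewrite ffunE.
by have [_ _] := phiP i; exact.
Qed.

End BorelProduct.

(** * Polish spaces: countable bases and approximation of open sets *)

Lemma polish_second_countable (R : realType) (T : ptopologicalType) :
  polish R T -> @second_countable T.
Proof.
move=> [[D cD dD] [M [f [g [cf cg fK gK _]]]]].
pose b (p : T * nat) : set T := f @^-1` (ball (f p.1) (2 / p.2.+1%:R : R))°.
have ob p : open (b p).
  by apply: open_comp; [move=> x _; exact: cf|exact: open_interior].
exists (b @` (D `*` setT)).
  exact: card_le_trans (card_image_le _ _) (countableX cD (countableP _)).
split => [_ [p _ <-]//|x O Ox].
have : nbhs (f x) (g @^-1` O) by apply: cg; rewrite fK.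
move=> /nbhs_ballP[e /= e0 eO].
(* A dense point within [1 / k.+1] of [x] has a ball of radius [2 / k.+1] that contains a
   neighbourhood of [x] and stays within [3 / k.+1] of [x]. *)
have [k ke] : exists k : nat, 3 / k.+1%:R < e :> R.
  have [k _ /(_ k (leqnn k)) kP] :=
    near_infty_natSinv_lt (PosNum (divr_gt0 e0 (ltr0n R 3))).
  exists k; move: kP => /=; rewrite ltr_pdivlMr// mulrC//.
have k0 : 0 < 1 / k.+1%:R :> R by rewrite divr_gt0.
have [d [dx Dd]] : f @^-1` (ball (f x) (1 / k.+1%:R : R))° `&` D !=set0.
  apply: dD; last first.
    by apply: open_comp; [move=> y _; exact: cf|exact: open_interior].
  by exists x; apply: nbhsx_ballx.
exists (b (d, k)) => /=.
  split; first by exists (d, k).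
  rewrite /b /=; apply: filterS (nbhsx_ballx (f x) _ k0).
  move=> y; rewrite (_ : 2 / _ = 1 / k.+1%:R + 1 / k.+1%:R :> R).
    by apply: ball_triangle; apply: ball_sym; exact: interior_subset dx.
  by rewrite -mulrDl.
move=> y /interior_subset /= dy; rewrite -(fK y); apply: eO.
apply: le_ball (ltW ke) _ _; rewrite (_ : 3 / _ = 1 / k.+1%:R + 2 / k.+1%:R :> R).
  by apply: ball_triangle dy; exact: interior_subset dx.
by rewrite -mulrDl.
Qed.

(** Take [n] times the distance to the complement of [U], cut off at 1. It vanishes outside [U], and
    at a point of [U] it is eventually 1 because the distance there is positive. *)
Lemma polish_open_approx (R : realType) (T : ptopologicalType) (U : set T) :
  polish R T -> open U ->
  exists phi : nat -> T -> R,
    [/\ forall n, continuous (phi n), forall n x, 0 <= phi n x <= 1 &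
        forall x, phi n x @[n --> \oo] --> (\1_U x : R)].
Proof.
move=> [_ [M [f [g [cf cg fK gK _]]]]] oU.
(* Adjoining 1 truncates the distance and keeps the infimum meaningful when [U] is the whole
   space. *)
pose S x : set R := [set mdist (f x) (f a) | a in ~` U] `|` [set 1].
pose dist x := inf (S x).
have S0 x : S x !=set0 by exists 1; right.
have S_ge0 x : lbound (S x) 0.
  by move=> _ [[a _ <-]|->] //; exact: mdist_ge0.
have dist_lb x : lbound (S x) (dist x) by apply: ge_inf; exists 0; exact: S_ge0.
have dist0 x : 0 <= dist x by exact: lb_le_inf.
have dist_triangle x y : dist x <= mdist (f x) (f y) + dist y.
  rewrite -lerBlDl; apply: lb_le_inf => // _ [[a Ua <-]|->]; rewrite lerBlDl.
    apply: le_trans (metric_triangle _ (f y) _).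
    by apply: dist_lb; left; exists a.
  rewrite (@le_trans _ _ 1) ?lerDr ?mdist_ge0//.
  by apply: dist_lb; right.
have cdist : continuous dist.
  move=> x; apply/cvgrPdist_lt => e e0.
  have : nbhs x (f @^-1` ball (f x) e) by apply: cf; exact: nbhsx_ballx.
  apply: filterS => y /=; rewrite ballEmdist /= => xy.
  apply: le_lt_trans xy; rewrite ler_norml lerBlDr lerBrDr.
  rewrite dist_triangle andbT addrC lerBlDl.
  by rewrite metric_sym dist_triangle.
have distN x : ~ U x -> dist x = 0.
  move=> Ux; apply/eqP; rewrite eq_le dist0 andbT.
  by apply: dist_lb; left; exists x => //; rewrite mdistxx.
have dist_gt0 x : U x -> 0 < dist x.
  move=> Ux; have : nbhs (f x) (g @^-1` U).
    by apply: cg; rewrite fK; exact: open_nbhs_nbhs.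
  move=> /nbhs_ballP[e /= e0 eU].
  apply: (@lt_le_trans _ _ (Num.min e 1)); first by rewrite lt_min e0 ltr01.
  apply: lb_le_inf => // _ [[a Ua <-]|->]; rewrite ge_min ?lexx ?orbT//.
  rewrite leNgt; apply/orP; left; apply/negP => ae; apply: Ua.
  by rewrite -(fK a); apply: eU; rewrite ballEmdist.
exists (fun n x => Num.min 1 (n%:R * dist x)); split.
- move=> n x; apply: (@continuous_min R T (cst 1) (fun x => n%:R * dist x)).
    exact: cvg_cst.
  by apply: cvgMl_tmp; exact: cdist.
- by move=> n x; rewrite le_min ler01 mulr_ge0//= ge_min lexx.
- move=> x; apply: cvg_near_cst; rewrite indicE.
  case: (pselect (U x)) => Ux; last first.
    rewrite memNset//; apply: nearW => n.
    by rewrite distN// mulr0 min_r.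
  rewrite mem_set//; near=> n; rewrite min_l//.
  rewrite -ler_pdivrMr ?dist_gt0//; near: n; exact: nbhs_infty_ger.
Unshelve. all: by end_near. Qed.

(** * Sigma-algebras of blocks of coordinates *)

Section Projections.
Context (V : finType) (X : V -> ptopologicalType).

Local Notation T := (borel (prod_topology X)).
Local Notation cyl A := (@box V X (fun v => v \in A)).

Lemma measurable_coordinate (i : V) : measurable_fun setT (@coordinate V X i).
Proof.
apply: (@continuous_borel_measurable (prod_topology X)).
exact: proj_continuous.
Qed.

Lemma measurable_projection (A : {set V}) :
  measurable_fun setT (@projection V X A).
Proof.
apply: (@continuous_borel_measurable (prod_topology X) (subproduct X A)).
by apply: continuous_prod_topology => i; exact: proj_continuous.
Qed.

Lemma preimage_projection_box (A : {set V}) (B : pred {v | v \in A})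
    (U : forall v, set (X v)) :
  @projection V X A @^-1` box B (fun i => U (val i)) =
  box (fun v => if insub v is Some i then B i else false) U.
Proof.
apply/seteqP; split => [x xU v|x xU i Bi].
  by case: insubP => // i vA iv; case: _ / iv => /xU.
by apply: xU; rewrite valK.
Qed.

Lemma projection_box (A B : {set V}) (U : forall v, set (X v)) :
  B \subset A -> (forall v, open (U v)) ->
  g_sigma_algebra_preimage (@projection V X A) (cyl B U).
Proof.
move=> BA oU.
exists (box (fun i : {v | v \in A} => val i \in B) (fun i => U (val i))).
  by apply: measurable_box => i; exact: oU.
rewrite setTI preimage_projection_box; congr box; apply/funext => v.
case: insubP => [i vA <-//|vA]; apply/esym/negP => vB.
by move: vA; rewrite (fintype.subsetP BA _ vB).
Qed.

Lemma projection_coordinate (A : {set V}) (i : V) (B : set (borel (X i))) :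
  i \in A -> measurable B ->
  g_sigma_algebra_preimage (@projection V X A) (@coordinate V X i @^-1` B).
Proof.
move=> iA mB; exists ((fun x : borel (subproduct X A) => x (Sub i iA)) @^-1` B).
  rewrite -[_ @^-1` _]setTI.
  have := @continuous_borel_measurable (subproduct X A) (X i)
    (fun x => x (Sub i iA)); apply => //.
  exact: (@proj_continuous _ (fun v : {v | v \in A} => X (val v)) (Sub i iA)).
by rewrite setTI.
Qed.

Lemma projection_subset (A B : {set V}) : B \subset A ->
  g_sigma_algebra_preimage (@projection V X B) `<=`
  g_sigma_algebra_preimage (@projection V X A).
Proof.
move=> /fintype.subsetP BA _ [S mS <-].
pose r (x : borel (subproduct X A)) : borel (subproduct X B) :=
  fun i => x (Sub (val i) (BA _ (valP i))).
exists (r @^-1` S) => //.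
rewrite -[_ @^-1` _]setTI.
have : measurable_fun setT r; last exact.
apply: (@continuous_borel_measurable (subproduct X A) (subproduct X B)).
apply: continuous_prod_topology => i.
exact: (@proj_continuous _ (fun v : {v | v \in A} => X (val v))
  (Sub (val i) (BA _ (valP i)))).
Qed.

Lemma measurable_fun_projection_subset d (Y : measurableType d)
    (A B : {set V}) (f : T -> Y) : B \subset A ->
  measurable_fun [set: g_sigma_algebra_preimageType (@projection V X B)] f ->
  measurable_fun [set: g_sigma_algebra_preimageType (@projection V X A)] f.
Proof.
move=> BA mf _ S mS; apply: (projection_subset BA).
exact: (mf measurableT).
Qed.

Hypothesis scX : forall v, @second_countable (X v).

(** Open boxes generate the Borel sets of the subproduct, and their preimages under the projection
    are the open cylinders over [A]. *)
Lemma sigma_projection (A : {set V}) :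
  g_sigma_algebra_preimage (@projection V X A) =
  <<s open_boxes (fun v => v \in A) >>.
Proof.
rewrite /g_sigma_algebra_preimage.
rewrite (@borel_prod_boxes _ (fun v : {v | v \in A} => X (val v))); last first.
  by move=> i; exact: scX.
rewrite -g_sigma_preimageE; congr (<<s _ >>).
have predA : (fun v => if insub v is Some i then predT (i : {v | v \in A})
    else false) = (fun v => v \in A).
  apply/funext => v; case: insubP => [i -> //|/negPf -> //].
apply/seteqP; split => [_ [_ [U oU ->] <-]|_ [U oU ->]].
  (* Quantifying over the proof of membership extends the sides to all of [V], by the whole space
     outside [A]. *)
  exists (fun v => [set y : X v | forall h : v \in A, U (exist _ v h) y]).
    move=> v; case: (pselect (v \in A)) => vA.
      rewrite (_ : [set _ | _] = U (exist _ v vA)); first exact: oU.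
      apply/seteqP; split => [y /(_ vA)//|y Uy h].
      by rewrite (bool_irrelevance h vA).
    rewrite (_ : [set _ | _] = setT); first exact: openT.
    by apply/seteqP; split => // y _ h; case: (vA h).
  rewrite setTI; apply/seteqP; split => [x xU v vA h|x xU [v vA] _ /=].
    exact: xU.
  exact: xU.
exists (box predT (fun i => U (val i))).
  by exists (fun i => U (val i)) => // i; exact: oU.
by rewrite setTI preimage_projection_box predA.
Qed.

(** The open cylinders over [A] are stable under intersection, contain the whole space and generate
    the sigma-algebra, so the uniqueness theorem for finite measures applies. *)
Lemma projection_measure_unique (R : realType) (A : {set V})
    (m1 m2 : {finite_measure set T -> \bar R}) :
  (forall U : forall v, set (X v), (forall v, open (U v)) ->
    m1 (cyl A U) = m2 (cyl A U)) ->
  forall D, g_sigma_algebra_preimage (@projection V X A) D -> m1 D = m2 D.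
Proof.
move=> m12 D; rewrite sigma_projection.
apply: (@g_sigma_algebra_measure_unique _ R T _ _ (fun=> setT)) => //.
- by move=> _ [U oU ->]; exact: measurable_box.
- by move=> _; exact: open_boxesT.
- by rewrite bigcup_const.
- exact: open_boxesI.
- by move=> _ [U oU ->]; exact: m12.
- by move=> _; rewrite ltey_eq fin_num_measure.
Qed.

End Projections.
Arguments measurable_coordinate {V} X i.
Arguments measurable_projection {V} X A.

(** * Independence of blocks *)

Section BlockIndependence.
Context (R : realType) (V : finType) (X : V -> ptopologicalType).
Hypothesis scX : forall v, @second_countable (X v).

Local Notation T := (borel (prod_topology X)).
Local Notation cyl A := (@box V X (fun v => v \in A)).
Local Notation sigma A := (g_sigma_algebra_preimage (@projection V X A)).
Local Notation sigmaType A :=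
  (g_sigma_algebra_preimageType (@projection V X A)).

(** Only open cylinders are tested: they determine independence of the two sigma-algebras, and their
    indicators are limits of products of continuous functions. *)
Definition indep_blocks (P : probability T R) (A B : {set V}) : Prop :=
  forall U W : forall v, set (X v),
    (forall v, open (U v)) -> (forall v, open (W v)) ->
    (P (cyl A U `&` cyl B W) = P (cyl A U) * P (cyl B W))%E.

Variables (P : probability T R) (A B : {set V}).
Hypothesis indepAB : indep_blocks P A B.

Let mA D : sigma A D -> measurable D.
Proof. exact: (preimage_measurable (measurable_projection X A)). Qed.

Let mB D : sigma B D -> measurable D.
Proof. exact: (preimage_measurable (measurable_projection X B)). Qed.

(** Uniqueness of measures is used once per block: with the other event fixed, both sides are finite
    measures in the remaining one. *)
Lemma indep_blocks_sigma D E : sigma A D -> sigma B E ->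
  (P (D `&` E) = P D * P E)%E.
Proof.
have scale_fine (E' F : set T) : measurable E' ->
    (mscale (NngNum (fine_ge0 (measure_ge0 P E'))) P F = P E' * P F)%E.
  by move=> mE; rewrite /mscale /= fineK// fin_num_measure.
have step W D' : (forall v, open (W v)) -> sigma A D' ->
    (P (D' `&` cyl B W) = P D' * P (cyl B W))%E.
  move=> oW; have mW : measurable (cyl B W : set T) by exact: measurable_box.
  move=> sD'; rewrite [RHS]muleC -scale_fine//.
  apply: (projection_measure_unique scX (m1 := mrestr P mW)
    (m2 := mscale (NngNum (fine_ge0 (measure_ge0 P (cyl B W)))) P) _ sD').
  by move=> U oU; rewrite [RHS]scale_fine// muleC -indepAB.
move=> sD sE; have mD := mA sD; rewrite -scale_fine// setIC.
apply: (projection_measure_unique scX (m1 := mrestr P mD)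
  (m2 := mscale (NngNum (fine_ge0 (measure_ge0 P D))) P) _ sE).
by move=> W oW; rewrite [RHS]scale_fine// -step// setIC.
Qed.

Lemma indep_blocks_cond_prob E : sigma B E ->
  cond_prob P (@projection V X A) E (cst (fine (P E))).
Proof.
move=> sE; have mE := mB sE; split.
- exact: measurable_cst.
- exact: finite_measure_integrable_cst.
- move=> D sD; rewrite [LHS](integral_cst P (mA sD) (fine (P E))%:E).
  by rewrite fineK ?fin_num_measure// setIC indep_blocks_sigma// muleC.
Qed.

(** This is the pull-out property, with the constant [P E] as conditional probability of [E] given
    the block [A]. *)
Lemma indep_blocks_integral_set (f : T -> \bar R) D E :
  measurable_fun [set: sigmaType A] f -> (forall x, 0 <= f x)%E ->
  sigma A D -> sigma B E ->
  (\int[P]_(x in D `&` E) f x = (\int[P]_(x in D) f x) * P E)%E.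
Proof.
move=> mf f0 sD sE; have mE := mB sE.
rewrite -(ge0_integral_cond_probM (measurable_projection X A) mE
  (indep_blocks_cond_prob sE))//.
rewrite /= ge0_integralZr//.
- by rewrite fineK// fin_num_measure.
- exact: mA.
- apply: measurable_funTS.
  exact: (measurable_fun_preimage (measurable_projection X A) mf).
- by rewrite lee_fin; exact: fine_ge0.
- by move=> x; exact: fine_ge0.
Qed.

(** On the sigma-algebra of [B], the measure with density [f] is [P] scaled by the integral of [f];
    integrating [g] against it gives the product. *)
Lemma indep_blocks_integralM (f g : T -> \bar R) :
  measurable_fun [set: sigmaType A] f -> measurable_fun [set: sigmaType B] g ->
  (forall x, 0 <= f x)%E -> (forall x, 0 <= g x)%E ->
  P.-integrable setT f ->
  (\int[P]_x (f x * g x) = (\int[P]_x f x) * (\int[P]_x g x))%E.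
Proof.
move=> mf mg f0 g0 fi.
have mpA := measurable_projection X A; have mpB := measurable_projection X B.
have mf' := measurable_fun_preimage mpA mf.
have mg' := measurable_fun_preimage mpB mg.
have c0 : 0 <= fine (\int[P]_x f x)%E by apply: fine_ge0; exact: integral_ge0.
have If : (fine (\int[P]_x f x))%:E = (\int[P]_x f x)%E.
  by rewrite fineK//; exact: integrable_fin_num.
under eq_integral do rewrite muleC.
rewrite -(@ge0_integral_density _ _ _ (density_measure f0 fi) P f g)//.
rewrite -(ge0_integral_trace mpB (density_measure f0 fi))//.
transitivity (\int[trace_measure mpB (mscale (NngNum c0) P)]_x g x)%E.
  apply: eq_measure_integral => E sE _.
  have H : (\int[P]_(x in E) f x = (\int[P]_x f x) * P E)%E.
    rewrite -[S in integral _ S]setTI indep_blocks_integral_set//.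
    exact: (@measurableT _ (sigmaType A)).
  by apply: (eq_trans H); apply: (congr1 (fun z => (z * P E)%E)); exact: esym If.
rewrite (ge0_integral_trace mpB (mscale (NngNum c0) P))//.
by rewrite ge0_integral_mscale//= If.
Qed.

End BlockIndependence.

Lemma continuous_borel_measurable_real (R : realType) (S : ptopologicalType)
    (f : S -> R) : continuous f -> measurable_fun [set: borel S] f.
Proof.
move=> cf.
apply: (@measurability _ _ (borel S) _ setT f _ (RGenOpens.measurableE R)).
move=> _ [_ [a [b ->]] <-]; rewrite setTI; apply: sub_sigma_algebra.
apply: open_comp; first by move=> x _; exact: cf.
exact: interval_open.
Qed.

(* Unlike proj_continuous, this does not need decidable equality of indices. *)
Lemma prod_topology_eval_continuous (I : Type) (K : I -> topologicalType) i :
  continuous (fun f : prod_topology K => f i).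
Proof.
move=> f U fU.
have /cvg_sup/(_ i) : (f : prod_topology K) --> f by exact: cvg_id.
by apply; exact: (@initial_continuous _ _ (fun f : (forall i, K i) => f i) f).
Qed.

(** * Weak closedness of block independence *)

Section ClosedIndependence.
Context (R : realType) (V : finType) (X : V -> ptopologicalType).
Hypothesis pX : forall v, polish R (X v).

Local Notation T := (borel (prod_topology X)).
Local Notation cyl A := (@box V X (fun v => v \in A)).
Local Notation sigmaType A :=
  (g_sigma_algebra_preimageType (@projection V X A)).

Let scX v : @second_countable (X v) := polish_second_countable (pX v).

Definition block_fun (A : {set V}) (phi : forall v, X v -> R)
  (x : prod_topology X) : R := \prod_(v in A) phi v (x v).

(** The bounds 0 and 1 pass to products over blocks, which are therefore bounded by 1, as weak
    convergence and dominated convergence require. *)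
Definition test_family (phi : forall v, X v -> R) : Prop :=
  forall v, continuous (phi v) /\ forall y, 0 <= phi v y <= 1.

Lemma block_fun_ge0_le1 A phi x : test_family phi -> 0 <= block_fun A phi x <= 1.
Proof.
move=> tphi; apply/andP; split.
  by apply: prodr_ge0 => v _; have [_ /(_ (x v))/andP[]] := tphi v.
by apply: prodr_ile1 => v _; have [_] := tphi v; exact.
Qed.

Lemma block_fun_continuous A phi :
  test_family phi -> continuous (block_fun A phi).
Proof.
move=> tphi; rewrite /block_fun; apply: continuous_big => [|v _].
  exact: mul_continuous.
have [cphi _] := tphi v.
by move=> x; apply: continuous_comp; [exact: proj_continuous|exact: cphi].
Qed.

Lemma block_fun_measurable A phi : test_family phi ->
  measurable_fun [set: sigmaType A] (block_fun A phi).
Proof.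
move=> tphi.
rewrite (_ : block_fun A phi =
    fun x => \prod_(v <- enum A) phi v (x v)); last first.
  by apply/funext => x; rewrite /block_fun big_enum.
apply: measurable_prod => v; rewrite mem_enum => vA _ B mB; rewrite setTI.
apply: (@projection_coordinate _ _ _ _ (phi v @^-1` B)) => //.
rewrite -[_ @^-1` _]setTI; have [cphi _] := tphi v.
exact: (continuous_borel_measurable_real cphi).
Qed.

Lemma block_fun_integrable (P : probability T R) A phi : test_family phi ->
  P.-integrable setT (EFin \o block_fun A phi).
Proof.
move=> tphi; apply: measurable_bounded_integrable => //.
- by rewrite (le_lt_trans (probability_le1 _ _)) ?ltry.
- exact: (@continuous_borel_measurable_real R (prod_topology X) _
    (block_fun_continuous tphi)).
exists 1; split; first exact: num_real.
move=> M M1 x _; have /andP[h0 h1] := block_fun_ge0_le1 A x tphi.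
by rewrite /= ger0_norm// (le_trans h1)// ltW.
Qed.

Definition block_test (A : {set V}) phi (tphi : test_family phi) :
  @bounded_continuous R (prod_topology X).
Proof.
exists (block_fun A phi); split; first exact: block_fun_continuous.
exists 1; split; first exact: num_real.
move=> M M1 x _; have /andP[h0 h1] := block_fun_ge0_le1 A x tphi.
by rewrite /= ger0_norm// (le_trans h1)// ltW.
Defined.

Definition block_test2 (A B : {set V}) phi psi
  (tphi : test_family phi) (tpsi : test_family psi) :
  @bounded_continuous R (prod_topology X).
Proof.
exists (fun x => block_fun A phi x * block_fun B psi x); split.
  by move=> x; apply: cvgM; exact: block_fun_continuous.
exists 1; split; first exact: num_real.
move=> M M1 x _; have /andP[h0 h1] := block_fun_ge0_le1 A x tphi.
have /andP[k0 k1] := block_fun_ge0_le1 B x tpsi.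
rewrite /= ger0_norm ?mulr_ge0// (le_trans _ (ltW M1))//.
by rewrite (le_trans (ler_wpM2r k0 h1)) ?mul1r.
Defined.

Lemma indep_blocks_test (P : probability T R) (A B : {set V}) phi psi
    (tphi : test_family phi) (tpsi : test_family psi) :
  indep_blocks P A B ->
  integral_functional P (block_test2 A B tphi tpsi) =
  integral_functional P (block_test A tphi) *
  integral_functional P (block_test B tpsi).
Proof.
move=> indepAB; rewrite /integral_functional /Rintegral /=.
under eq_integral do rewrite EFinM.
rewrite (indep_blocks_integralM scX indepAB
  (f := EFin \o block_fun A phi) (g := EFin \o block_fun B psi)).
- by rewrite fineM//; apply: integrable_fin_num => //; exact: block_fun_integrable.
- exact/measurable_EFinP/block_fun_measurable.
- exact/measurable_EFinP/block_fun_measurable.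
- by move=> x /=; rewrite lee_fin; case/andP: (block_fun_ge0_le1 A x tphi).
- by move=> x /=; rewrite lee_fin; case/andP: (block_fun_ge0_le1 B x tpsi).
- exact: block_fun_integrable.
Qed.

(** The indicator of a cylinder is the product of the indicators of its sides, and a finite product
    passes to the limit. *)
Lemma block_fun_cvg (A : {set V}) (phi : forall v, nat -> X v -> R)
    (U : forall v, set (X v)) (x : prod_topology X) :
  (forall v y, phi v n y @[n --> \oo] --> (\1_(U v) y : R)) ->
  block_fun A (fun v => phi v n) x @[n --> \oo] --> (\1_(cyl A U) x : R).
Proof.
move=> cphi; rewrite (_ : \1_(cyl A U) x = \prod_(v in A) \1_(U v) (x v) :> R).
  rewrite /block_fun; apply: cvg_big => [|v _]; first exact: mul_continuous.
  exact: cphi.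
rewrite indicE; case: (pselect (cyl A U x)) => [xU|xU].
  rewrite mem_set// big1// => v vA; rewrite indicE mem_set//; exact: xU.
rewrite memNset//; apply/esym/eqP/prodf_eq0.
move/existsNP : xU => [v /not_implyP[vA xU]].
by exists v => //; rewrite indicE memNset.
Qed.

Lemma integral_cvg_set (P : probability T R) (f : nat -> T -> R) (B : set T) :
  measurable B -> (forall n, measurable_fun setT (f n)) ->
  (forall n x, 0 <= f n x <= 1) ->
  (forall x, f n x @[n --> \oo] --> (\1_B x : R)) ->
  (\int[P]_x f n x)%R @[n --> \oo] --> fine (P B).
Proof.
move=> mB mf f01 cf.
have : (\int[P]_x (f n x)%:E)%E @[n --> \oo] --> (\int[P]_x (\1_B x)%:E)%E.
  apply: (@dominated_cvg _ _ _ _ _ _ _ _ (cst 1%E)) => //.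
  - by move=> n; exact/measurable_EFinP.
  - by move=> x _; apply/fine_cvgP; split; [exact: nearW|exact: cf].
  - exact: finite_measure_integrable_cst.
  - move=> n x _; have /andP[h0 h1] := f01 n x.
    by rewrite /= ger0_norm// lee_fin.
have -> : (\int[P]_x (\1_B x)%:E = (fine (P B))%:E)%E.
  by rewrite integral_indic// setIT fineK// fin_num_measure.
by move/fine_cvgP => [_].
Qed.

(** Approximate the indicator of each side by continuous functions. By dominated convergence both
    sides of the product formula converge, and uniqueness of limits gives it for the cylinders. *)
Lemma test_indep_blocks (P : probability T R) (A B : {set V}) :
  (forall phi psi (tphi : test_family phi) (tpsi : test_family psi),
    integral_functional P (block_test2 A B tphi tpsi) =
    integral_functional P (block_test A tphi) *
    integral_functional P (block_test B tpsi)) ->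
  indep_blocks P A B.
Proof.
move=> H U W oU oW.
pose phi v := sval (cid (polish_open_approx (pX v) (oU v))).
pose psi v := sval (cid (polish_open_approx (pX v) (oW v))).
have tphi n : test_family (fun v => phi v n).
  by move=> v; rewrite /phi; case: cid => /= f [cf f01 _].
have tpsi n : test_family (fun v => psi v n).
  by move=> v; rewrite /psi; case: cid => /= f [cf f01 _].
have cphi v y : phi v n y @[n --> \oo] --> (\1_(U v) y : R).
  by rewrite /phi; case: cid => /= f [_ _]; exact.
have cpsi v y : psi v n y @[n --> \oo] --> (\1_(W v) y : R).
  by rewrite /psi; case: cid => /= f [_ _]; exact.
have mU : measurable (cyl A U : set T) by exact: measurable_box.
have mW : measurable (cyl B W : set T) by exact: measurable_box.
have mblock C f : test_family f -> measurable_fun [set: T] (block_fun C f).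
  move=> tf; exact: (@continuous_borel_measurable_real R (prod_topology X) _
    (block_fun_continuous tf)).
have cA : integral_functional P (block_test A (tphi n)) @[n --> \oo] -->
    fine (P (cyl A U)).
  apply: integral_cvg_set => //= [n|n x|x]; first exact: mblock.
    exact: block_fun_ge0_le1.
  exact: block_fun_cvg.
have cB : integral_functional P (block_test B (tpsi n)) @[n --> \oo] -->
    fine (P (cyl B W)).
  apply: integral_cvg_set => //= [n|n x|x]; first exact: mblock.
    exact: block_fun_ge0_le1.
  exact: block_fun_cvg.
have cAB : integral_functional P (block_test2 A B (tphi n) (tpsi n))
    @[n --> \oo] --> fine (P (cyl A U `&` cyl B W)).
  apply: integral_cvg_set => //= [|n|n x|x].
  - exact: measurableI.
  - by apply: measurable_funM; exact: mblock.
  - have /andP[h0 h1] := block_fun_ge0_le1 A x (tphi n).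
    have /andP[k0 k1] := block_fun_ge0_le1 B x (tpsi n).
    by rewrite mulr_ge0//= (le_trans (ler_wpM2r k0 h1)) ?mul1r.
  - by rewrite indicI; apply: cvgM; exact: block_fun_cvg.
have E : fine (P (cyl A U `&` cyl B W)) = fine (P (cyl A U)) * fine (P (cyl B W)).
  apply: cvg_unique cAB _; first exact: norm_hausdorff.
  rewrite (_ : (fun n => _) =
    (fun n => integral_functional P (block_test A (tphi n))) \*
    (fun n => integral_functional P (block_test B (tpsi n)))).
    exact: cvgM cA cB.
  by apply/funext => n /=; rewrite H.
have mUW := measurableI _ _ mU mW.
by rewrite -(@fineK _ (P _)) ?fin_num_measure// E EFinM !fineK ?fin_num_measure.
Qed.

(** The set is an intersection, over pairs of test families, of zero sets of weakly continuous
    functions of [P]. *)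
Lemma closed_indep_blocks (A B : {set V}) :
  closed [set P : weak_probability R (prod_topology X) | indep_blocks P A B].
Proof.
pose tests := {phi : forall v, X v -> R | test_family phi}.
pose I := @integral_functional R (prod_topology X).
have cI f : continuous (fun P : weak_probability R (prod_topology X) => I P f).
  move=> P; apply: (@continuous_comp (weak_probability R (prod_topology X))
    {ptws bounded_continuous R (prod_topology X) -> R} R I (fun u => u f)).
    exact: initial_continuous.
  exact: prod_topology_eval_continuous.
rewrite (_ : [set _ | _] = \bigcap_(p in [set: tests * tests])
  [set P | I P (block_test2 A B (svalP p.1) (svalP p.2)) -
    I P (block_test A (svalP p.1)) * I P (block_test B (svalP p.2)) = 0]).
  apply: closed_bigI => p _.
  apply: (@closed_comp _ _ _ [set x : R | x = 0]); last exact: closed_eq.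
  move=> P _.
  have cA := cI (block_test A (svalP p.1)) P.
  have cB := cI (block_test B (svalP p.2)) P.
  exact: cvgB (cI (block_test2 A B (svalP p.1) (svalP p.2)) P) (cvgM cA cB).
apply/seteqP; split => [P indepP [phi psi] _ /=|P testP].
  by rewrite /I indep_blocks_test// subrr.
apply: test_indep_blocks => phi psi tphi tpsi.
apply/eqP; rewrite -subr_eq0; apply/eqP.
exact: (testP (exist _ phi tphi, exist _ psi tpsi)).
Qed.

End ClosedIndependence.

(** * Transitively closed graphs without splits *)

Lemma indep_blocksC (R : realType) (V : finType) (X : V -> ptopologicalType)
    (P : probability (borel (prod_topology X)) R) (A B : {set V}) :
  indep_blocks P A B -> indep_blocks P B A.
Proof. by move=> AB U W oU oW; rewrite setIC muleC AB. Qed.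

Lemma mem_pa (V : finType) (G : digraph V) (i j : V) : (j \in pa G i) = G j i.
Proof. by rewrite inE. Qed.

Lemma edge_dsc (V : finType) (G : digraph V) (i j : V) : G i j -> j \in dsc G i.
Proof.
move=> Gij; rewrite finset.in_set finset.in_set.
by apply/asboolP; exists [:: j] => //=; rewrite Gij.
Qed.

Lemma mem_dsc (V : finType) (G : digraph V) i j :
  (j \in dsc G i) = (i \in an G j).
Proof. by rewrite finset.in_set. Qed.

Lemma edge_an (V : finType) (G : digraph V) i j : G i j -> i \in an G j.
Proof. by move=> /edge_dsc; rewrite finset.in_set. Qed.

Lemma an_trans (V : finType) (G : digraph V) i j k :
  i \in an G j -> j \in an G k -> i \in an G k.
Proof.
rewrite !finset.in_set => /asboolP[p p0 [pG <-]] /asboolP[q q0 [qG <-]].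
apply/asboolP; exists (p ++ q); first by case: p p0 {pG qG}.
by rewrite cat_path pG last_cat.
Qed.


Section TransitivelyClosed.
Context (V : finType) (G : digraph V).
Hypothesis tG : transitively_closed G.

Lemma transitively_closed_edge i j k : G i j -> G j k -> G i k.
Proof. by rewrite -!mem_pa; exact: tG. Qed.

Lemma transitively_closed_dsc i j : (j \in dsc G i) = G i j.
Proof.
apply/idP/idP => [|/edge_dsc//].
rewrite finset.in_set finset.in_set => /asboolP[p p0 [pG <-]].
case: p p0 pG => //= k p _ /andP[Gik pG].
elim: p k Gik pG => //= l p IH k Gik /andP[Gkl pG].
exact: IH (transitively_closed_edge Gik Gkl) pG.
Qed.

Definition ancestral (A : {set V}) : Prop :=
  forall i j, i \in A -> G j i -> j \in A.

(** A vertex of [A] with the most parents works: by transitivity, the head of an edge from [v]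
    inherits all parents of [v] and has [v] as a further one. *)
Lemma exists_sink (A : {set V}) : A != finset.set0 ->
  exists2 v, v \in A & forall w, w \in A -> ~~ G v w.
Proof.
case/set0Pn => v0 v0A.
case: (@arg_maxnP _ v0 (fun v => v \in A) (fun v => #|pa G v|) v0A) => v vA vmax.
exists v => // w wA; apply/negP => Gvw.
suff : (#|pa G v| < #|pa G w|)%N.
  by have := vmax w wA; rewrite /geq /= leqNgt => /negPf->.
apply: proper_card; apply/properP; split.
  apply/fintype.subsetP => u; rewrite !mem_pa => Guv.
  exact: transitively_closed_edge Guv Gvw.
by exists v; rewrite mem_pa// edge_irrefl.
Qed.

(** In a transitively closed graph, these are the vertices other than [i] that no edge joins to
    [i]. *)
Definition incomparable (i : V) : {set V} :=
  (~: (dsc G i :|: [set i]) :\: pa G i)%SET.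

Lemma nondescendantsE i :
  (~: (dsc G i :|: [set i]) = pa G i :|: incomparable i)%SET.
Proof.
apply/finset.setP => j.
rewrite !(finset.in_setU, finset.in_setC, finset.in_setD, finset.in_set1).
rewrite mem_pa transitively_closed_dsc.
have [Gji|//] := boolP (G j i).
rewrite /= negb_or; apply/andP; split; apply/negP.
  by move=> Gij; have := transitively_closed_edge Gij Gji; rewrite edge_irrefl.
by move=> /eqP ji; rewrite ji edge_irrefl in Gji.
Qed.

Lemma ancestral_pa i : ancestral (i |: pa G i).
Proof.
move=> j k; rewrite !finset.in_setU !finset.in_set1 !mem_pa.
move=> /orP[/eqP -> ->|Gji Gkj].
  by rewrite orbT.
by rewrite (transitively_closed_edge Gkj Gji) orbT.
Qed.

(** Let [m] be a parent of [k], with [k] incomparable to [i]. An edge from [m] to [i] would create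
    the split [m, i, k]; an edge from [i] to [m], or [m = i], would give an edge from [i] to [k]. *)
Lemma ancestral_incomparable i : ~ has_split G -> ancestral (incomparable i).
Proof.
move=> nsG k m; rewrite !finset.in_setD !finset.in_setC !finset.in_setU.
rewrite !finset.in_set1 !mem_pa.
rewrite !transitively_closed_dsc !negb_or => /and3P[Gki Gik ki] Gmk.
apply/and3P; split.
- apply/negP => Gmi; apply: nsG; exists m, i, k; split.
  + by rewrite eq_sym.
  + by rewrite finset.in_setI !mem_pa Gmi.
  + by rewrite mem_pa.
  + by rewrite mem_pa.
- by apply: contra Gik => Gim; exact: transitively_closed_edge Gim Gmk.
- by apply: contra Gik => /eqP <-.
Qed.

Lemma disjoint_incomparable i j :
  j \in (i |: pa G i)%SET -> j \notin incomparable i.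
Proof.
rewrite !(finset.in_setU, finset.in_setC, finset.in_setD, finset.in_set1).
by case: (j == i); case: (j \in pa G i); rewrite ?andbF ?orbT.
Qed.

End TransitivelyClosed.

(** * Compatibility as independence of ancestral blocks *)

Section CompatibleIndependence.
Context (R : realType) (V : finType) (G : digraph V).
Context (X : V -> ptopologicalType).
Hypotheses (tG : transitively_closed G) (scX : forall v, @second_countable (X v)).

Local Notation T := (borel (prod_topology X)).
Local Notation cyl A := (@box V X (fun v => v \in A)).
Local Notation sigma A := (g_sigma_algebra_preimage (@projection V X A)).
Local Notation nondsc i := (~: (dsc G i :|: [set i]))%SET.

(** Induction on the total size of the blocks. A sink [v] of the union, say in [A], has its parents
    in [A] without [v], and all other vertices of the two blocks are nondescendants of [v]. *)
Lemma compatible_indep_blocks (P : probability T R) (A B : {set V}) :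
  compatible G P -> ancestral G A -> ancestral G B ->
  (forall v, v \in A -> v \notin B) -> indep_blocks P A B.
Proof.
move=> cP; have [n] := ubnP (#|A| + #|B|)%N.
elim: n A B => // n IH A B ABn aA aB dAB.
have [AB0|/(exists_sink tG)[v vAB vsink]] := eqVneq (A :|: B)%SET finset.set0.
  move=> U W oU oW.
  have cT (C : {set V}) S : (C \subset A :|: B)%SET -> cyl C S = setT.
    rewrite AB0 => /fintype.subsetP C0; apply/seteqP; split => // x _ w /C0.
    by rewrite finset.in_set0.
  by rewrite !cT ?finset.subsetUl ?finset.subsetUr// setIT probability_setT mul1e.
wlog vA : A B aA aB dAB vAB vsink ABn / v \in A.
  move=> H; case/finset.setUP : (vAB) => vA; first exact: H.
  apply: indep_blocksC; apply: H => //.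
  - by move=> w wB; apply/negP => wA; have := dAB w wA; rewrite wB.
  - by rewrite finset.setUC.
  - by move=> w; rewrite finset.setUC; exact: vsink.
  - by rewrite addnC.
move=> U W oU oW.
pose A' := (A :\ v)%SET.
have sinkA w : w \in A -> ~~ G v w.
  by move=> wA; apply: vsink; rewrite finset.in_setU wA.
have sinkB w : w \in B -> ~~ G v w.
  by move=> wB; apply: vsink; rewrite finset.in_setU wB orbT.
have aA' : ancestral G A'.
  move=> j k; rewrite !finset.in_setD1 => /andP[_ jA] Gkj.
  rewrite (aA _ _ jA Gkj) andbT; apply/eqP => kv.
  by have := sinkA j jA; rewrite -kv Gkj.
have indepA'B : indep_blocks P A' B.
  apply: IH => //.
  - by move: ABn; rewrite (cardsD1 v A) vA addSn ltnS.
  - by move=> w /finset.setD1P[_ /dAB].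
have paA' : pa G v \subset A'.
  apply/fintype.subsetP => w; rewrite mem_pa finset.in_setD1 => Gwv.
  rewrite (aA _ _ vA Gwv) andbT; apply/eqP => wv.
  by rewrite wv edge_irrefl in Gwv.
have nondscA' : A' \subset nondsc v.
  apply/fintype.subsetP => w; rewrite finset.in_setD1 => /andP[wv wA].
  rewrite finset.in_setC finset.in_setU finset.in_set1 transitively_closed_dsc//.
  by rewrite negb_or wv sinkA.
have nondscB : B \subset nondsc v.
  apply/fintype.subsetP => w wB.
  rewrite finset.in_setC finset.in_setU finset.in_set1 transitively_closed_dsc//.
  rewrite negb_or sinkB//=; apply/eqP => wv.
  by have := dAB v vA; rewrite -wv wB.
have mpA := measurable_projection X (pa G v).
have mC := @measurable_coordinate V X v.
have mUv : measurable (U v : set (borel (X v))).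
  by apply: sub_sigma_algebra; exact: oU.
have mCU : measurable (@coordinate V X v @^-1` U v).
  by rewrite -[_ @^-1` _]setTI; exact: mC.
have [p pP p0] := cond_prob_ex P mpA mCU.
(* Compatibility at [v]: the conditional probability given the parents also computes joint
   probabilities with any event of the nondescendants. *)
have int_p D : sigma (nondsc v) D ->
    (\int[P]_(x in D) (p x)%:E = P (@coordinate V X v @^-1` U v `&` D))%E.
  move=> [S mS <-]; rewrite setTI.
  exact: (cond_indep_integral (measurable_projection X (nondsc v)) mpA mUv
    (cP v) pP p0 mS).
have boxA : cyl A U = @coordinate V X v @^-1` U v `&` cyl A' U.
  apply/seteqP; split => [x xU|x [xv xU] w wA].
    split; first exact: xU.
    by move=> w /finset.setD1P[_]; exact: xU.
  by have [->//|wv] := eqVneq w v; apply: xU; rewrite finset.in_setD1 wv.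
(* Both probabilities involving [v] become integrals of [p], which is measurable for the block [A'],
   so the independence of [A'] and [B] finishes the proof. *)
rewrite boxA -setIA -!int_p; first last.
- exact: projection_box.
- apply: (@measurableI _
    (g_sigma_algebra_preimageType (@projection V X (nondsc v))));
    exact: projection_box.
apply: (indep_blocks_integral_set scX indepA'B).
- have [mp _ _] := pP; apply/measurable_EFinP.
  exact: (measurable_fun_projection_subset paA' mp).
- by move=> x; rewrite lee_fin.
- exact: projection_box.
- exact: projection_box.
Qed.

(** By [integral_cond_indep], it suffices to integrate [p], the conditional probability given the
    parents, over events of the nondescendants. Independence splits off the incomparable part, and
    on the parents the identity defines [p]. *)
Lemma indep_blocks_compatible (P : probability T R) :
  (forall i, indep_blocks P (i |: pa G i)%SET (incomparable G i)) ->
  compatible G P.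
Proof.
move=> indepP i.
have mpA := measurable_projection X (pa G i).
have mC := @measurable_coordinate V X i.
have paN : pa G i \subset nondsc i by rewrite nondescendantsE// finset.subsetUl.
have paI : pa G i \subset (i |: pa G i)%SET by rewrite finset.subsetUr.
apply: integral_cond_indep => //.
- exact: measurable_projection.
- exact: projection_subset.
move=> B1 mB1.
have mCB : measurable (@coordinate V X i @^-1` B1).
  by rewrite -[_ @^-1` _]setTI; exact: mC.
have [p pP p0] := cond_prob_ex P mpA mCB.
exists p; split => // B2 mB2.
have [mp ip pE] := pP.
have p0' x : (0 <= (EFin \o p) x)%E by rewrite lee_fin.
have mpI : measurable_fun
    [set: g_sigma_algebra_preimageType (@projection V X (i |: pa G i)%SET)]
    (EFin \o p).
  by apply/measurable_EFinP; exact: (measurable_fun_projection_subset paI mp).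
rewrite [in RHS]setIC.
(* Both sides are finite measures of the event of the nondescendants, so open cylinders are
   enough. *)
apply: (projection_measure_unique scX (A := nondsc i)
  (m1 := density_measure p0' ip) (m2 := mrestr P mCB)); last first.
  by exists B2 => //; rewrite setTI.
move=> U oU.
have -> : cyl (nondsc i) U = cyl (pa G i) U `&` cyl (incomparable G i) U.
  rewrite nondescendantsE//; apply/seteqP; split => [x xU|x [xU xU'] w].
    by split => w wA; apply: xU; rewrite finset.in_setU wA ?orbT.
  by move=> /finset.setUP[]; [exact: xU|exact: xU'].
transitivity ((\int[P]_(x in cyl (pa G i) U) (p x)%:E) *
    P (cyl (incomparable G i) U))%E.
  apply: (indep_blocks_integral_set scX (indepP i)) => //.
  - exact: projection_box.
  - exact: projection_box.
rewrite pE; last exact: projection_box.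
rewrite -(indep_blocks_sigma scX (indepP i)).
- by rewrite -setIA setIC.
- apply: (@measurableI _
    (g_sigma_algebra_preimageType (@projection V X (i |: pa G i)%SET))).
    by apply: projection_coordinate => //; rewrite finset.in_setU1 eqxx.
  exact: projection_box.
- exact: projection_box.
Qed.

End CompatibleIndependence.

Lemma closed_compatible_measures (R : realType) (V : finType) (G : digraph V)
    (X : V -> ptopologicalType) :
  transitively_closed G -> ~ has_split G -> (forall v, polish R (X v)) ->
  closed (compatible_measures R G X).
Proof.
move=> tG nsG pX; have scX v := polish_second_countable (pX v).
rewrite (_ : compatible_measures R G X = \bigcap_(i in [set: V])
    [set P : weak_probability R (prod_topology X) |
      indep_blocks P (i |: pa G i)%SET (incomparable G i)]).
  by apply: closed_bigI => i _; exact: closed_indep_blocks.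
apply/seteqP; split => [P cP i _|P indepP].
  apply: (compatible_indep_blocks tG scX cP).
  - exact: ancestral_pa.
  - exact: ancestral_incomparable.
  - exact: disjoint_incomparable.
by apply: (indep_blocks_compatible tG scX) => i; exact: indepP.
Qed.

(** * Laws with two atoms *)

Lemma cond_indepC (R : realType) d d1 d2 d3 (T : measurableType d)
    (T1 : measurableType d1) (T2 : measurableType d2) (T3 : measurableType d3)
    (P : probability T R) (X : T -> T1) (Y : T -> T2) (Z : T -> T3) :
  cond_indep P X Y Z -> cond_indep P Y X Z.
Proof.
move=> XYZ B2 B1 mB2 mB1; have [p [q [r [pP qP rP rpq]]]] := XYZ B1 B2 mB1 mB2.
exists q, p, r; split => //; first by rewrite setIC.
by move: rpq; apply: filterS => x ->; rewrite mulrC.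
Qed.

Section TwoPoint.
Context (R : realType) d (T : measurableType d) (x y : T).

Definition two_point : set T -> \bar R :=
  mscale (2^-1)%:nng (measure_add \d_x \d_y).

HB.instance Definition _ := Measure.on two_point.

Lemma two_pointE (A : set T) : two_point A = ((\1_A x + \1_A y) / 2)%:E.
Proof.
have -> : two_point A = ((2^-1)%:E * (\d_x A + \d_y A))%E.
  by congr (_ * _)%E; exact: measure_addE.
by rewrite !diracE mulrC.
Qed.

Let two_pointT : two_point setT = 1%E.
Proof. by rewrite two_pointE !indicE !in_setT /=; congr EFin; field. Qed.

HB.instance Definition _ :=
  Measure_isProbability.Build _ _ _ two_point two_pointT.

Lemma ge0_integral_two_point (D : set T) (f : T -> R) : measurable D ->
  measurable_fun setT f -> (forall z, 0 <= f z) ->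
  (\int[two_point]_(z in D) (f z)%:E =
   ((\1_D x * f x + \1_D y * f y) / 2)%:E)%E.
Proof.
move=> mD mf f0; have mfD : measurable_fun D (EFin \o f).
  by apply/measurable_EFinP; exact: measurable_funTS.
rewrite ge0_integral_mscale//; last by move=> z _; rewrite lee_fin.
rewrite ge0_integral_measure_add//; last by move=> z _; rewrite lee_fin.
by rewrite !integral_dirac// !diracE mulrC.
Qed.

Lemma integrable_two_point (f : T -> R) : measurable_fun setT f ->
  two_point.-integrable setT (EFin \o f).
Proof.
move=> mf; apply/integrableP; split; first exact/measurable_EFinP.
rewrite (_ : (fun z => _) = (fun z => `|f z|%:E)); last exact/funext.
by rewrite ge0_integral_two_point ?ltry//; exact: measurableT_comp.
Qed.

Lemma integral_two_point (D : set T) (f : T -> R) : measurable D ->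
  measurable_fun setT f ->
  (\int[two_point]_(z in D) (f z)%:E =
   ((\1_D x * f x + \1_D y * f y) / 2)%:E)%E.
Proof.
move=> mD mf.
have mnf : measurable_fun setT (fun z => `|f z|) by exact: measurableT_comp.
have mfnf : measurable_fun setT (fun z => f z + `|f z|) by exact: measurable_funD.
(* Writing [f] as [f + |f|] minus [|f|] reduces the claim to nonnegative functions. *)
under eq_integral => z _ do rewrite -[f z](addrK `|f z|) EFinB.
rewrite integralB_EFin//; last 2 first.
- by apply: integrableS (integrable_two_point mfnf).
- by apply: integrableS (integrable_two_point mnf).
rewrite !ge0_integral_two_point//.
  by rewrite -EFinB; congr EFin; ring.
by move=> z; have := ler_norm (- f z); rewrite normrN; lra.
Qed.

Lemma two_point_ae (Q : T -> Prop) : {ae two_point, forall z, Q z} -> Q x.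
Proof.
move=> [N [mN N0 QN]]; apply: contrapT => Qx.
have : (0 < two_point N)%E.
  rewrite two_pointE lte_fin indicE mem_set; last exact: QN.
  by rewrite divr_gt0// ltr_pwDl//= indicE.
by rewrite N0 ltxx.
Qed.

End TwoPoint.

(** * Conditional independence under a law with two atoms *)

Section TwoPointIndependence.
Context (R : realType) (d d1 d2 d3 : measure_display).
Context (T : measurableType d) (T1 : measurableType d1)
  (T2 : measurableType d2) (T3 : measurableType d3).
Variables (x y : T) (X : T -> T1) (Y : T -> T2) (Z : T -> T3).
Hypotheses (mX : measurable_fun setT X) (mY : measurable_fun setT Y)
  (mZ : measurable_fun setT Z).

Local Notation P := (two_point R x y).

Let mXB B : measurable B -> measurable (X @^-1` B).
Proof. by move=> mB; rewrite -[_ @^-1` _]setTI; exact: mX. Qed.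

Let mYB B : measurable B -> measurable (Y @^-1` B).
Proof. by move=> mB; rewrite -[_ @^-1` _]setTI; exact: mY. Qed.

Lemma cond_prob_two_point (A : set T) (h : T -> R) : measurable A ->
  measurable_fun [set: g_sigma_algebra_preimageType Z] h ->
  (forall D, g_sigma_algebra_preimage Z D ->
    \1_D x * h x + \1_D y * h y = \1_(A `&` D) x + \1_(A `&` D) y) ->
  cond_prob P Z A h.
Proof.
move=> mA mh hE; have mh' := measurable_fun_preimage mZ mh; split => //.
  exact: integrable_two_point.
move=> D mD; have mD' := preimage_measurable mZ mD.
by rewrite integral_two_point// hE//; exact: (esym (two_pointE R x y _)).
Qed.

Lemma cond_prob_two_pointE (A : set T) (h : T -> R) D : measurable A ->
  cond_prob P Z A h -> g_sigma_algebra_preimage Z D ->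
  \1_D x * h x + \1_D y * h y = \1_(A `&` D) x + \1_(A `&` D) y.
Proof.
move=> mA [mh _ hE] mD; have mh' := measurable_fun_preimage mZ mh.
have mD' := preimage_measurable mZ mD.
have := hE D mD; rewrite integral_two_point//.
move=> E; have := etrans E (two_pointE R x y _) => -[]; lra.
Qed.

(** [X] is almost surely constant, so its events have constant conditional probability [c], equal to
    0 or 1, and the joint one is [c] times that of the event of [Y]. *)
Lemma two_point_cond_indep_const : X x = X y -> cond_indep P X Y Z.
Proof.
move=> Xxy B1 B2 mB1 mB2.
have [q qP q0] := cond_prob_ex P mZ (mYB mB2).
pose c : R := \1_(X @^-1` B1) x.
have cy : \1_(X @^-1` B1) y = c.
  by rewrite /c !indicE -[y \in _]/(X y \in B1) -Xxy.
exists (cst c), q, (fun z => c * q z); split => //; last exact: aeW.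
- apply: cond_prob_two_point; [exact: mXB|exact: measurable_cst|].
  by move=> D mD; rewrite !indicI /= cy -/c; ring.
- have [mq _ _] := qP; apply: cond_prob_two_point.
  + by apply: measurableI; [exact: mXB|exact: mYB].
  + exact: measurable_funM.
  + move=> D mD; have := cond_prob_two_pointE (mYB mB2) qP mD.
    rewrite !indicI /= cy -/c => qE.
    by rewrite -!mulrA -mulrDr -qE; ring.
Qed.

(** [Z] reveals the atom through [S]. Given [Z], an event has conditional probability 0 or 1
    according to whether it contains the atom revealed, and such values multiply under
    intersection. *)
Lemma two_point_cond_indep_separated (S : set T) :
  g_sigma_algebra_preimage Z S -> S x -> ~ S y -> cond_indep P X Y Z.
Proof.
move=> mS Sx Sy B1 B2 mB1 mB2.
pose h (A : set T) (z : T) : R := \1_A x * \1_S z + \1_A y * \1_(~` S) z.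
have Sx1 : \1_S x = 1 :> R by rewrite indicE mem_set.
have Sy0 : \1_S y = 0 :> R by rewrite indicE memNset.
have SCx : \1_(~` S) x = 0 :> R by rewrite indicE memNset//=; apply.
have SCy : \1_(~` S) y = 1 :> R by rewrite indicE mem_set.
have hP A : measurable A -> cond_prob P Z A (h A).
  move=> mA; apply: cond_prob_two_point => //.
    apply: measurable_funD; apply: measurable_funM => //.
    apply: (@measurable_indic _ (g_sigma_algebra_preimageType Z)).
    exact: (@measurableC _ (g_sigma_algebra_preimageType Z)).
  by move=> D mD; rewrite /h Sx1 Sy0 SCx SCy !indicI /=; ring.
exists (h (X @^-1` B1)), (h (Y @^-1` B2)), (h (X @^-1` B1 `&` Y @^-1` B2)).
split; [exact/hP/mXB|exact/hP/mYB|apply: hP; apply: measurableI|].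
- exact: mXB.
- exact: mYB.
apply: aeW => z; rewrite /h !indicI /= !indicE in_setC.
by case: (z \in S) => /=; ring.
Qed.

(** [Z] does not distinguish the atoms, so at [x] the two events and their intersection all have
    conditional probability 1/2, which is not its own square. *)
Lemma two_point_not_cond_indep (B1 : set T1) (B2 : set T2) :
  measurable B1 -> measurable B2 -> Z x = Z y ->
  B1 (X x) -> ~ B1 (X y) -> B2 (Y x) -> ~ B2 (Y y) -> ~ cond_indep P X Y Z.
Proof.
move=> mB1 mB2 Zxy X1 X0 Y1 Y0 /(_ B1 B2 mB1 mB2)[p [q [r [pP qP rP rpq]]]].
have mT : g_sigma_algebra_preimage Z setT.
  exact: (@measurableT _ (g_sigma_algebra_preimageType Z)).
have hE A (h : T -> R) : measurable A -> A x -> ~ A y -> cond_prob P Z A h ->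
    h x = 1 / 2.
  move=> mA Ax Ay hP; have [mh _ _] := hP.
  (* The level set of [h] through [x] is a preimage under [Z], so it contains [y] as well. *)
  have hxy : h y = h x.
    have [S mS SE] := mh measurableT [set h x] (measurable_set1 _).
    have : (setT `&` Z @^-1` S) y.
      split => //=; rewrite -Zxy.
      by have [] : (setT `&` Z @^-1` S) x by rewrite SE; split.
    by rewrite SE => -[].
  have := cond_prob_two_pointE mA hP mT.
  rewrite setIT !indicE !in_setT hxy (mem_set Ax) (memNset Ay) /=; lra.
have mXB1 := mXB mB1; have mYB2 := mYB mB2.
have : r x = p x * q x := two_point_ae rpq.
rewrite (hE _ _ mXB1 _ _ pP)// (hE _ _ mYB2 _ _ qP)//.
rewrite (hE _ _ (measurableI _ _ mXB1 mYB2) _ _ rP)//; last by case.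
by move/eqP; rewrite -subr_eq0 => /eqP; lra.
Qed.

End TwoPointIndependence.

Lemma continuous_weak_probability (R : realType) (S : topologicalType)
    (T : ptopologicalType) (g : S -> weak_probability R T) :
  (forall f, continuous (fun s => integral_functional (g s) f)) -> continuous g.
Proof.
move=> cg x U [_ [[B oB <-] Bx] BU].
have : continuous (fun s => integral_functional (g s)).
  by apply: continuous_prod_topology => f; exact: cg.
move=> /(_ x B) /= nB.
have : nbhs x ((fun s => integral_functional (g s)) @^-1` B).
  by apply: nB; exact: open_nbhs_nbhs.
by apply: filterS => s Bs; exact: BU.
Qed.

(** * Random signs on the vertices *)

Section Counterexample.
Context (R : realType) (V : finType) (G : digraph V).

Local Notation X := (fun _ : V => R : ptopologicalType).
Local Notation T := (borel (prod_topology X)).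

(** The law of the vector [w] multiplied by a fair random sign. *)
Definition symmetric_law (w : prod_topology X) : probability T R :=
  two_point R (w : T) (fun v => - w v).

(** For nonzero [c] these are the reals of the same sign as [c]; a coordinate with value [c] or
    [- c] shows the random sign through this set. *)
Let open_half_line (c : R) : open [set r : R | 0 < r * c].
Proof.
apply: (@open_comp _ _ (fun r : R => r * c) [set r | 0 < r]); last exact: open_gt.
by move=> r _; exact: mulrr_continuous.
Qed.

Let measurable_half_line (c : R) :
  measurable ([set r : R | 0 < r * c] : set (borel (R : ptopologicalType))).
Proof. by apply: sub_sigma_algebra; exact: open_half_line. Qed.

(** The three cases: the coordinate at [v] is constant, a parent already reveals the sign, or all
    nondescendants are constant. *)
Lemma symmetric_law_compatible (w : prod_topology X) :
  (forall v, [\/ w v = 0, exists2 u, G u v & w u != 0 |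
    forall u, u \notin (dsc G v :|: [set v])%SET -> w u = 0]) ->
  compatible G (symmetric_law w).
Proof.
move=> wP i.
have mC := @measurable_coordinate V X i.
have mpa := measurable_projection X (pa G i).
have mN := measurable_projection X (~: (dsc G i :|: [set i]))%SET.
case: (wP i) => [wi|[u Gui wu]|w0].
- by apply: two_point_cond_indep_const => //; rewrite /coordinate wi oppr0.
- apply: (two_point_cond_indep_separated R mC mN mpa
    (S := @coordinate V X u @^-1` [set r | 0 < r * w u])).
  + by apply: projection_coordinate; [rewrite mem_pa|exact: measurable_half_line].
  + by rewrite /= /coordinate -expr2 exprn_even_gt0.
  + by apply/negP; rewrite /= /coordinate mulNr oppr_gt0 -leNgt -expr2 sqr_ge0.
- apply: cond_indepC; apply: two_point_cond_indep_const => //.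
  apply: functional_extensionality_dep => -[u uN] /=; rewrite /projection /=.
  by rewrite w0 ?oppr0// -finset.in_setC.
Qed.

(** The parents of [b] carry no information, while [b] and its nondescendant [a] both show the
    sign. *)
Lemma symmetric_law_not_compatible (w : prod_topology X) (a b : V) :
  w a != 0 -> w b != 0 -> a \notin (dsc G b :|: [set b])%SET ->
  (forall u, G u b -> w u = 0) -> ~ compatible G (symmetric_law w).
Proof.
move=> wa wb ab w0 /(_ b).
have mC := @measurable_coordinate V X b.
have mpa := measurable_projection X (pa G b).
have mN := measurable_projection X (~: (dsc G b :|: [set b]))%SET.
have aN : a \in (~: (dsc G b :|: [set b]))%SET by rewrite finset.in_setC.
have [S mS SE] :=
  @projection_coordinate V X _ a _ aN (measurable_half_line (w a)).
apply: (@two_point_not_cond_indep R _ _ _ _ _ _ _ _ _ _ _ _ _ mC mN mpa _ _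
  (measurable_half_line (w b)) mS).
- apply: functional_extensionality_dep => -[u ub] /=; rewrite /projection /=.
  by rewrite w0 ?oppr0// -mem_pa.
- by rewrite /= /coordinate -expr2 exprn_even_gt0.
- by apply/negP; rewrite /= /coordinate mulNr oppr_gt0 -leNgt -expr2 sqr_ge0.
- have [] // : (setT `&` @projection V X _ @^-1` S) w.
  by rewrite SE /= /coordinate -expr2 exprn_even_gt0.
- move=> Sw; have : (setT `&` @projection V X _ @^-1` S) (fun v => - w v) by [].
  by rewrite SE /= /coordinate mulNr oppr_gt0 ltNge -expr2 sqr_ge0.
Qed.

Lemma integral_symmetric_law (w : prod_topology X)
    (f : @bounded_continuous R (prod_topology X)) :
  integral_functional (symmetric_law w) f =
  (sval f w + sval f (fun v => - w v)) / 2.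
Proof.
case: f => f [cf bf]; rewrite /integral_functional /Rintegral /=.
have mf : measurable_fun [set: T] f.
  exact: (@continuous_borel_measurable_real R (prod_topology X) _ cf).
rewrite [in LHS](@integral_two_point R _ T w (fun v => - w v) setT f
  measurableT mf).
by rewrite !indicE !in_setT !mul1r.
Qed.

Lemma symmetric_law_continuous (w : R -> prod_topology X) :
  (forall v, continuous (fun e => w e v)) ->
  continuous ((fun e => symmetric_law (w e)) : R -> weak_probability R _).
Proof.
move=> cw; apply: continuous_weak_probability => f.
under eq_fun do rewrite integral_symmetric_law.
have cw1 : continuous w by exact: continuous_prod_topology.
have cw2 : continuous (fun e => (fun v => - w e v) : prod_topology X).
  by apply: continuous_prod_topology => v e; apply: cvgN; exact: cw.
case: f => f [cf bf] /= e; apply: cvgMr_tmp; apply: cvgD.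
  exact: (continuous_comp (cw1 e) (cf (w e))).
exact: (continuous_comp (cw2 e) (cf _)).
Qed.

(** The disjunction treats the fork at [m] and the chain through [m] together. Acyclicity enters
    only through [a \notin dsc G b], which puts [a] among the nondescendants of [b]. *)
Lemma compatible_measures_not_closed (a b m : V) :
  a != b -> G m b -> G m a || G a m -> ~~ G a b -> a \notin dsc G b ->
  ~ closed (compatible_measures R G X).
Proof.
move=> ab Gmb Gma nGab ab_dsc clG.
have irr v u : G u v -> (u == v) = false.
  by move=> Guv; apply/eqP => uv; rewrite uv edge_irrefl in Guv.
have mb := irr _ _ Gmb.
have ma : (m == a) = false by case/orP: Gma => /irr //; rewrite eq_sym.
have ba : (b == a) = false by rewrite eq_sym; exact: negbTE.
have am : (a == m) = false by rewrite eq_sym.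
have bm : (b == m) = false by rewrite eq_sym.
pose w (e : R) : prod_topology X :=
  fun v => (v == a)%:R + (v == b)%:R + e * (v == m)%:R.
have wa e : w e a = 1 by rewrite /w eqxx (negbTE ab) am mulr0 !addr0.
have wb e : w e b = 1 by rewrite /w eqxx ba bm mulr0 addr0 add0r.
have wm e : w e m = e by rewrite /w eqxx ma mb !add0r mulr1.
have w0 e u : u != a -> u != b -> u != m -> w e u = 0.
  by move=> /negbTE ua /negbTE ub /negbTE um; rewrite /w ua ub um mulr0 !addr0.
suff : compatible G (symmetric_law (w 0)).
  apply: (@symmetric_law_not_compatible _ a b).
  - by rewrite wa oner_neq0.
  - by rewrite wb oner_neq0.
  - by rewrite finset.in_setU finset.in_set1 negb_or ab_dsc ab.
  - move=> u Gub; have [->|um] := eqVneq u m; first exact: wm.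
    apply: w0 => //; last by rewrite (irr _ _ Gub).
    by apply/eqP => ua; rewrite ua (negbTE nGab) in Gub.
(* Let [e] tend to 0 through nonzero values, for which the laws are compatible. *)
apply: (@closed_cvg _ (weak_probability R (prod_topology X)) (0^') _
  (fun e => symmetric_law (w e)) _ clG).
- have := nbhs_dnbhs_neq (0 : R); apply: filterS => e e0.
  apply: symmetric_law_compatible => v.
  have [->|va] := eqVneq v a.
    case/orP: Gma => [Gma|Gam]; first by constructor 2; exists m; rewrite ?wm.
    (* In the chain, [m] and [b] descend from [a], so [w e] vanishes at every nondescendant of [a]
       other than [a]. *)
    constructor 3 => u; rewrite finset.in_setU finset.in_set1 negb_or.
    move=> /andP[ud ua].
    apply: w0 => //.
    + apply: contra ud => /eqP ->; rewrite mem_dsc.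
      exact: an_trans (edge_an Gam) (edge_an Gmb).
    + by apply: contra ud => /eqP ->; exact: edge_dsc.
  have [->|vb] := eqVneq v b; first by constructor 2; exists m; rewrite ?wm.
  have [->|vm] := eqVneq v m; last by constructor 1; exact: w0.
  have [Gam|nGam] := boolP (G a m).
    by constructor 2; exists a; rewrite ?wa ?oner_neq0.
  rewrite (negbTE nGam) orbF in Gma.
  (* In the fork, [a] and [b] are children of [m], so [w e] vanishes at every nondescendant of [m]
     other than [m]. *)
  constructor 3 => u; rewrite finset.in_setU finset.in_set1 negb_or.
  move=> /andP[ud um].
  apply: w0 => //.
  + by apply: contra ud => /eqP ->; exact: edge_dsc.
  + by apply: contra ud => /eqP ->; exact: edge_dsc.
- have cw v : continuous (fun e => w e v).
    move=> e; apply: cvgD; first exact: cvg_cst.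
    by apply: cvgMr_tmp; exact: cvg_id.
  have := symmetric_law_continuous cw; move=> /(_ 0).
  by apply: cvg_trans; apply: cvg_app; exact: nbhs_dnbhs.
Qed.

End Counterexample.

Theorem proposition4p13 (R : realType) (V : finType) (G : digraph V)
    (dagG : is_dag G) :
  (transitively_closed G /\ ~ has_split G ->
     forall X : V -> ptopologicalType, (forall v, polish R (X v)) ->
       closed (compatible_measures R G X)) /\
  (~ (transitively_closed G /\ ~ has_split G) ->
     ~ closed (compatible_measures R G (fun _ : V => R : ptopologicalType))).
Proof.
split => [[tG nsG] X pX|ntG]; first exact: closed_compatible_measures.
have [[i [j [k [jk + jk_pa kj_pa]]]]|nsG] := pselect (has_split G).
  rewrite finset.in_setI !mem_pa => /andP[Gij Gik].
  rewrite !mem_pa in jk_pa kj_pa.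
  (* The two ends of the split play symmetric roles. If [j] descends from [k], they are exchanged,
     since by acyclicity [k] does not descend from [j]. *)
  have [jk_dsc|jk_dsc] := boolP (j \in dsc G k); last first.
    by apply: (compatible_measures_not_closed jk Gik) => //; rewrite Gij.
  apply: (@compatible_measures_not_closed _ _ _ k j i) => //.
  - by rewrite eq_sym.
  - by rewrite Gik.
  - apply/negP => kj_dsc; rewrite !mem_dsc in jk_dsc kj_dsc.
    by have := dagG k; rewrite (an_trans jk_dsc kj_dsc).
have [i [j [k [Gij Gjk nGik]]]] : exists i j k, [/\ G i j, G j k & ~~ G i k].
  apply: contrapT => H; apply: ntG; split => // i j k; rewrite !mem_pa => Gij Gjk.
  by apply: contrapT => /negP nGik; apply: H; exists i, j, k.
have an_ik : i \in an G k := an_trans (edge_an Gij) (edge_an Gjk).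
(* A failure of transitivity is the chain with middle vertex [j]; acyclicity gives the distinctness
   of its ends and keeps [i] from descending from [k]. *)
apply: (@compatible_measures_not_closed _ _ _ i k j) => //.
- by apply/eqP => ik; have := dagG i; rewrite {2}ik an_ik.
- by rewrite Gij orbT.
- apply/negP; rewrite mem_dsc => an_ki.
  by have := dagG i; rewrite (an_trans an_ik an_ki).
Qed.
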